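(* Let $n$ be an odd deficient perfect number with exactly four distinct prime factors, written $n = p_1^{a_1} p_2^{a_2} p_3^{a_3} p_4^{a_4}$, where $p_1 < p_2 < p_3 < p_4$ are primes and $a_1, a_2, a_3, a_4 \geq 1$ are integers. Then (1) $p_1 = 3$, and (2) $5 \leq p_2 \leq 7$.
   Context: For a positive integer $n$, $\sigma(n)$ denotes the sum of the positive divisors of $n$. A positive integer $n$ is called a deficient perfect number if there is a positive proper divisor $d$ of $n$ (i.e. $d \mid n$, $1 \leq d < n$; $d = 1$ is allowed) such that $\sigma(n) = 2n - d$. *)

(* Defs.v *)
From mathcomp Require Import all_boot.

Set Implicit Arguments.
Unset Strict Implicit.
Unset Printing Implicit Defensive.

Definition sigma (n : nat) : nat := \sum_(d <- divisors n) d.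

(* The truncated subtraction is exact here, since d < n. *)
Definition deficient_perfect (n : nat) : Prop :=
  0 < n /\
  exists d : nat, [/\ 0 < d, d %| n, d < n & sigma n = 2 * n - d].

(* Main.v *)
(** Write [n = k d]; then [k sigma(n) = (2 k - 1) n], and since [sigma(n)] is odd
    every exponent is even. The abundancy bound [prod p / (p - 1)] forces
    [p1 = 3], and if [p2 >= 11] it forces [k = 3] or [k = 9]. For [k = 9] it leaves
    only the primes 3, 11, 13, 17, and none of them divides [sigma(11^a2)]. For
    [k = 3] we have [3 sigma(n) = 5 n]. Then 5 divides some [sigma(p^e)], which gives
    [p = 1 mod 5], [5 | e + 1] and [sigma(p^4) | 5 n]; as primes dividing
    [sigma(p^4) / 5] are 1 modulo 5, two of the three large primes are 1 modulo 5.
    In the same way 3 gives two of them that are 1 modulo 3, with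
    [(t^2 + t + 1) / 3] a product of powers of the other large primes. Combined with
    upper and lower bounds on the abundancy, these congruences leave finitely many
    triples of primes. *)

Require Import Defs.
From Stdlib Require Import ZArith.
From mathcomp Require Import all_boot zify.

Set Implicit Arguments.
Unset Strict Implicit.
Unset Printing Implicit Defensive.

(** * Geometric sums and their ratio to the top power *)

Definition geom (p a : nat) : nat := \sum_(i < a.+1) p ^ i.

Lemma geom0 p : geom p 0 = 1.
Proof. by rewrite /geom big_ord_recl big_ord0 expn0 addn0. Qed.

Lemma geomS p a : geom p a.+1 = 1 + p * geom p a.
Proof.
rewrite /geom big_ord_recl expn0 big_distrr; congr (_ + _).
by apply: eq_bigr => i _; rewrite expnS.
Qed.

Lemma geom2 p : geom p 2 = 1 + p * (1 + p).
Proof. by rewrite !geomS geom0 muln1. Qed.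

Lemma geom4 p : geom p 4 = 1 + p * (1 + p * (1 + p * (1 + p))).
Proof. by rewrite !geomS geom0 muln1. Qed.

Lemma geom_gt0 p a : 0 < geom p a.
Proof. by case: a => [|a]; rewrite ?geom0 ?geomS. Qed.

Lemma geom_pred p a : (p ^ a.+1).-1 = p.-1 * geom p a.
Proof. exact: predn_exp. Qed.

Lemma geom_expn p a : 0 < p -> p ^ a.+1 = 1 + p.-1 * geom p a.
Proof. by move=> p0; rewrite -geom_pred add1n prednK // expn_gt0 p0. Qed.

Lemma geom_modl p q a : geom (p %% q) a = geom p a %[mod q].
Proof.
elim: a => [|a IHa]; first by rewrite !geom0.
by rewrite !geomS -modnDmr -modnMm IHa modn_mod modnMm modnDmr.
Qed.

Lemma dvdn_geom p q a : (q %| geom p a) = (q %| geom (p %% q) a).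
Proof. by rewrite /dvdn geom_modl. Qed.

Lemma geom1 a : geom 1 a = a.+1.
Proof. by elim: a => [|a IHa]; rewrite ?geom0 // geomS IHa mul1n. Qed.

Lemma dvdn_geom_mod1 p q a : p %% q = 1 -> (q %| geom p a) = (q %| a.+1).
Proof. by move=> pq; rewrite dvdn_geom pq geom1. Qed.

Lemma dvdn_self_geom p a : 1 < p -> ~~ (p %| geom p a).
Proof.
move=> p1; case: a => [|a]; first by rewrite geom0 dvdn1; lia.
by rewrite geomS dvdn_addl ?dvdn_mulr // dvdn1; lia.
Qed.

Lemma odd_geom p a : odd p -> odd (geom p a) = ~~ odd a.
Proof.
by move=> pO; elim: a => [|a IHa]; rewrite ?geom0 // geomS oddD oddM pO IHa.
Qed.

Lemma dvdn_geom_geom p k a : 1 < p -> 0 < k -> k %| a.+1 -> geom p k.-1 %| geom p a.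
Proof.
move=> p1 k0 /dvdnP [m am].
have p1' : 0 < p.-1 by lia.
rewrite -(dvdn_pmul2l p1') -!geom_pred prednK // am mulnC expnM.
by rewrite (predn_exp (p ^ k)) dvdn_mulr.
Qed.

(** The ratio [geom p a / p ^ a] stays below [p / (p - 1)], hence below [(q + 1) / q]. Any [q < p]
    is allowed, so a lower bound on [p] suffices. *)
Lemma geom_ub q p a : q < p -> q * geom p a <= q.+1 * p ^ a.
Proof.
move=> qp; have p0 : 0 < p by lia.
have := geom_expn a p0; rewrite expnS.
have := geom_gt0 p a.
move: (geom p a) (p ^ a) => g N g0 E.
have [Ng|gN] := leqP N g; last by nia.
(* [E] amounts to [(p - 1) * (g - N) = N - 1], and [q <= p - 1]. *)
have qg : q * (g - N) <= p.-1 * (g - N) by rewrite leq_mul2r; lia.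
by rewrite !mulnBr in qg; nia.
Qed.

(** The ratio [geom p a / p ^ a] is a partial sum of the series of [1 / p ^ i], so it grows with
    [a]. *)
Lemma geom_lb p b a : b <= a -> geom p b * p ^ a <= geom p a * p ^ b.
Proof.
move=> ba; rewrite -(subnK ba); elim: (a - b) => [|c IHc] //.
rewrite addSn expnS geomS mulnCA mulnDl mul1n -mulnA.
by apply: leq_trans (leq_addl _ _); rewrite leq_mul2l IHc orbT.
Qed.

(** * The divisor sum: prime powers and multiplicativity *)

Lemma sigma_pfactor p a : prime p -> sigma (p ^ a) = geom p a.
Proof.
move=> pp; rewrite /sigma /geom.
rewrite -(big_mkord xpredT (fun i => p ^ i)) /index_iota subn0.
rewrite -(big_map (fun i => p ^ i) xpredT id).
apply: perm_big; apply: uniq_perm; first exact: divisors_uniq.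
  rewrite map_inj_uniq ?iota_uniq // => i j /eqP.
  by rewrite eqn_exp2l ?prime_gt1 // => /eqP.
move=> d; rewrite -dvdn_divisors ?expn_gt0 ?prime_gt0 //.
apply/dvdn_pfactor/mapP => // [[i ia ->]|[i]]; first by exists i; rewrite ?mem_iota.
by rewrite mem_iota => ia ->; exists i.
Qed.

(** Multiplication maps pairs of divisors bijectively onto the divisors of [m * n]; the inverse is
    [d] to [(gcdn d m, gcdn d n)]. *)
Lemma sigma_coprime m n : 0 < m -> 0 < n -> coprime m n ->
  sigma (m * n) = sigma m * sigma n.
Proof.
move=> m0 n0 cmn; rewrite /sigma big_distrlr /=.
rewrite -(big_allpairs_dep (h := muln) (r2 := fun=> divisors n) (F := id)).
apply: perm_big; apply: uniq_perm; first exact: divisors_uniq.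
- apply: allpairs_uniq; try exact: divisors_uniq.
  move=> [a b] [c d] /allpairsP [[a' b'] /= [am bn [-> ->]]].
  move=> /allpairsP [[c' d'] /= [cm dn [-> ->]]] /= E.
  move: am bn cm dn; rewrite -!dvdn_divisors // => am bn cm dn.
  have gl u v : u %| m -> v %| n -> gcdn (u * v) m = u.
    move=> um vn; rewrite gcdnC Gauss_gcdl; first exact/gcdn_idPr.
    exact: coprime_dvdr vn cmn.
  have gr u v : u %| m -> v %| n -> gcdn (u * v) n = v.
    move=> um vn; rewrite gcdnC Gauss_gcdr; first exact/gcdn_idPr.
    by rewrite coprime_sym; apply: coprime_dvdl um cmn.
  by congr (_, _); [rewrite -(gl a' b') // E gl | rewrite -(gr a' b') // E gr].
move=> d; rewrite -dvdn_divisors ?muln_gt0 ?m0 //.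
apply/idP/allpairsP => [dmn|[[a b] /= [am bn ->]]]; last first.
  by apply: dvdn_mul; rewrite dvdn_divisors.
exists (gcdn d m, gcdn d n); rewrite /= -!dvdn_divisors // !dvdn_gcdr; split=> //.
apply/eqP; rewrite eqn_dvd; apply/andP; split; last first.
  by rewrite Gauss_dvd ?dvdn_gcdl // (coprime_dvdl (dvdn_gcdr _ _)) // (coprime_dvdr (dvdn_gcdr _ _)).
rewrite muln_gcdr dvdn_gcd dvdn_mull //= muln_gcdl dvdn_gcd dmn andbT.
by rewrite dvdn_mulr.
Qed.

(** * Prime divisors of geometric sums *)

Lemma geomS_mod p q a : geom p a.+1 %% q = (1 + p * (geom p a %% q)) %% q.
Proof. by rewrite geomS -(modnDmr _ (_ * (_ %% _))) modnMmr modnDmr. Qed.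

(** Here [q.-1] plays -1: if [x ^ m] were 1, then [x ^ (k * m)] would be both 1 and -1 modulo
    [q]. *)
Lemma expn_odd_neq1 x k q m : 2 < q -> x ^ k = q.-1 %[mod q] -> odd m ->
  x ^ m <> 1 %[mod q].
Proof.
move=> q2 xk om xm.
have sq1 : q.-1 ^ 2 = 1 %[mod q].
  have -> : q.-1 ^ 2 = (q - 2) * q + 1 by rewrite -mulnn; nia.
  by rewrite modnMDl.
have : x ^ (k * m) = 1 %[mod q] by rewrite mulnC expnM -modnXm xm modnXm exp1n.
rewrite expnM -modnXm xk modnXm -(odd_double_half m) om add1n expnS -mul2n expnM.
rewrite -modnMmr -modnXm sq1 modnXm exp1n modnMmr muln1 !modn_small; lia.
Qed.

Lemma geom_ndvd x k q e : 2 < q -> 0 < x -> x ^ k = q.-1 %[mod q] -> ~~ odd e ->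
  ~~ (q %| geom x e).
Proof.
move=> q2 x0 xk oe; apply/negP => qg.
apply: (expn_odd_neq1 (m := e.+1) q2 xk); first by rewrite /= oe.
rewrite geom_expn // addnC; case/dvdnP: qg => c ->.
by rewrite mulnA modnMDl.
Qed.

(** Modulo 3 the sum is 1 for residue 0 and [e + 1] for residue 1; residue 2 is -1, so [geom_ndvd]
    applies. *)
Lemma dvd3_geom p e : 0 < p -> ~~ odd e -> 3 %| geom p e ->
  p %% 3 = 1 /\ 3 %| e.+1.
Proof.
move=> p0 oe dg; have := ltn_pmod p (isT : 0 < 3).
case E : (p %% 3) => [|[|[|//]]] _.
- move: dg; rewrite dvdn_geom E; case: (e) => [|f]; rewrite ?geom0 ?geomS //.
- by split=> //; rewrite -(dvdn_geom_mod1 e E).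
- suff /negP : ~~ (3 %| geom p e) by [].
  by apply: (@geom_ndvd _ 1); rewrite ?expn1.
Qed.

(** As for 3: the residues 2 and 3 have square -1 modulo 5, and 4 is -1. *)
Lemma dvd5_geom p e : 0 < p -> ~~ odd e -> 5 %| geom p e ->
  p %% 5 = 1 /\ 5 %| e.+1.
Proof.
move=> p0 oe dg; have := ltn_pmod p (isT : 0 < 5).
case E : (p %% 5) => [|[|[|[|[|//]]]]] _.
- move: dg; rewrite dvdn_geom E; case: (e) => [|f]; rewrite ?geom0 ?geomS //.
- by split=> //; rewrite -(dvdn_geom_mod1 e E).
- suff /negP : ~~ (5 %| geom p e) by [].
  by apply: (@geom_ndvd _ 2) => //; rewrite -modnXm E.
- suff /negP : ~~ (5 %| geom p e) by [].
  by apply: (@geom_ndvd _ 2) => //; rewrite -modnXm E.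
- suff /negP : ~~ (5 %| geom p e) by [].
  by apply: (@geom_ndvd _ 1) => //; rewrite expn1.
Qed.

(** The order of [p] modulo [q] divides the prime [r]. Order [r] makes [r] divide [q - 1]; order 1
    makes the sum congruent to [r]. *)
Lemma prime_dvd_geom p r q : 0 < p -> prime r -> prime q ->
  q %| geom p r.-1 -> q = r \/ q %% r = 1.
Proof.
move=> p0 pr pq qg.
have r1 := prime_gt1 pr; have q1 := prime_gt1 pq.
have Er : p ^ r = 1 %[mod q].
  have := geom_expn r.-1 p0; rewrite prednK ?prime_gt0 // => ->.
  by case/dvdnP: qg => c ->; rewrite addnC mulnA modnMDl.
have cpq : coprime p q.
  rewrite coprime_sym prime_coprime //; apply/negP => qp.
  have := dvdn_exp (prime_gt0 pr) qp; rewrite /dvdn Er modn_small //.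
have Eq : p ^ q.-1 = 1 %[mod q].
  have pq1 : 0 < p ^ q.-1 by rewrite expn_gt0 p0.
  apply/eqP; rewrite eqn_mod_dvd // -(@Gauss_dvdr _ p) 1?coprime_sym //.
  rewrite mulnBr muln1 -expnS prednK ?prime_gt0 // -eqn_mod_dvd ?fermat_little //.
  by rewrite -{1}(expn1 p) leq_pexp2l // prime_gt0.
have [crq|] := boolP (coprime r q.-1); last first.
  rewrite prime_coprime // negbK => /dvdnP [c qc]; right.
  have -> : q = c * r + 1 by lia.
  by rewrite modnMDl modn_small.
left; have p1 : p = 1 %[mod q].
  (* A Bezout relation between [r] and [q - 1] combines [Er] and [Eq]. *)
  have [u v Ev _] := egcdnP q.-1 (prime_gt0 pr).
  have : p ^ (u * r) = 1 %[mod q] by rewrite mulnC expnM -modnXm Er modnXm exp1n.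
  rewrite Ev (eqP crq) expnD expn1 mulnC => <-.
  by rewrite (mulnC v) expnM -modnMmr -modnXm Eq modnXm exp1n modnMmr muln1.
have := qg; rewrite dvdn_geom_mod1 ?p1 ?modn_small // prednK ?prime_gt0 //.
by rewrite dvdn_prime2 // => /eqP.
Qed.

Lemma modn1_of_primes m r : 1 < r -> 0 < m ->
  (forall q, prime q -> q %| m -> q %% r = 1) -> m %% r = 1.
Proof.
move=> r1; elim/ltn_ind: m => m IHm m0 H.
have [m1|m1] := leqP m 1; first by have -> : m = 1 by [lia]; rewrite modn_small.
have pm := pdiv_prime m1; have [c mc] := dvdnP (pdiv_dvd m).
have p1 := prime_gt1 pm.
rewrite {1}mc -modnMmr (H _ pm (pdiv_dvd m)) muln1.
apply: IHm; [nia|nia|move=> q pq qc].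
by apply: H => //; rewrite mc dvdn_mulr.
Qed.

Lemma prime_power_of_primes m p : 0 < m ->
  (forall q, prime q -> q %| m -> q = p) -> exists j, m = p ^ j.
Proof.
move=> m0 H; case/boolP: (prime p) => pp.
  have /p_natP [] // : p.-nat m.
    by apply/pnatP => // q pq qm; rewrite (H q pq qm) inE.
  by move=> j ->; exists j.
exists 0; case: (leqP m 1) => [|m1]; first by move=> ?; rewrite expn0; lia.
by move: pp; rewrite -(H _ (pdiv_prime m1) (pdiv_dvd m)) pdiv_prime.
Qed.

Lemma Euclid_dvd_prods (T : eqType) (F : T -> nat) (l : seq T) q : prime q ->
  q %| \prod_(c <- l) F c -> exists2 c, c \in l & q %| F c.
Proof.
move=> pq; elim: l => [|c l IHl]; first by rewrite big_nil Euclid_dvd1.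
rewrite big_cons Euclid_dvdM // => /orP [qc|/IHl [d dl qd]].
  by exists c; rewrite ?mem_head.
by exists d; rewrite ?inE ?dl ?orbT.
Qed.

(** * The equation 3 sigma(n) = 5 n: congruences modulo 5 and 3 *)

Section FiveThirds.

Variables (a : nat) (l : seq (nat * nat)).
Hypothesis ea : ~~ odd a.
Hypothesis hl : forall c, c \in l -> [/\ prime c.1, 5 < c.1 & ~~ odd c.2].
Hypothesis E : 3 * (geom 3 a * \prod_(c <- l) geom c.1 c.2)
             = 5 * (3 ^ a * \prod_(c <- l) c.1 ^ c.2).

Lemma dvd_geom_mem q : prime q -> q %| geom 3 a * \prod_(c <- l) geom c.1 c.2 ->
  [|| q == 3, q == 5 | q \in map fst l].
Proof.
move=> pq qs; have : q %| 5 * (3 ^ a * \prod_(c <- l) c.1 ^ c.2).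
  by rewrite -E dvdn_mull.
rewrite !Euclid_dvdM // Euclid_dvdX // (dvdn_prime2 pq (isT : prime 5)).
rewrite (dvdn_prime2 pq (isT : prime 3)) => /or3P [->|/andP [-> _]|].
- by rewrite orbT.
- by [].
case/(Euclid_dvd_prods pq) => c cl; rewrite Euclid_dvdX // => /andP [qc _].
have [pc _ _] := hl cl; move: qc; rewrite dvdn_prime2 // => /eqP ->.
by rewrite map_f ?orbT.
Qed.

Lemma dvd_geom_mem_other q c : c \in l -> prime q -> q %| geom c.1 c.2 ->
  [|| q == 3, q == 5 | (q \in map fst l) && (q != c.1)].
Proof.
move=> cl pq qc; have [pc _ _] := hl cl.
have -> : q != c.1.
  by apply: contraTneq qc => ->; apply/dvdn_self_geom/prime_gt1.
rewrite andbT; apply: dvd_geom_mem => //; apply: dvdn_mull.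
by rewrite (big_rem c) //= dvdn_mulr.
Qed.

Lemma dvd_geom3_mem q : prime q -> q %| geom 3 a -> q != 5 -> q \in map fst l.
Proof.
move=> pq qa q5; have := dvd_geom_mem pq (dvdn_mulr _ qa).
rewrite (negPf q5) /=; case/orP => // /eqP q3.
by move: qa; rewrite q3 (negPf (dvdn_self_geom _ _)).
Qed.

(** The factor 5 cannot come from [geom 3 a], as 3 is not 1 modulo 5, so it comes from a large prime
    [p]; [q] is a prime factor of the cofactor [m]. *)
Lemma ex_mod5 : exists p q m, [/\ p \in map fst l, q \in map fst l, q != p,
    p %% 5 = 1 & q %% 5 = 1] /\ [/\ geom p 4 = 5 * m, 0 < m, q %| m &
    forall s, prime s -> s %| m -> (s \in map fst l) && (s != p)].
Proof.
have p5 : prime 5 by [].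
have : 5 %| geom 3 a * \prod_(c <- l) geom c.1 c.2.
  rewrite -(@Gauss_dvdr 5 3) // E dvdn_mulr //.
rewrite Euclid_dvdM // => /orP [|/(Euclid_dvd_prods p5) [c cl]].
  by case/(dvd5_geom (isT : 0 < 3) ea).
have [pc c5 ec] := hl cl; have c0 : 0 < c.1 by lia.
case/(dvd5_geom c0 ec) => c1 c2.
have gd : geom c.1 4 %| geom c.1 c.2 by apply: (@dvdn_geom_geom _ 5) => //; lia.
have [k ck] : exists k, c.1 = 5 * k + 1 by exists (c.1 %/ 5); lia.
(* This is [geom c.1 4 / 5] expanded in [k], in a form showing that 5 does not divide it. *)
set m := 1 + 5 * (k * (2 + k * (10 + k * (25 + k * 25)))).
have Em : geom c.1 4 = 5 * m by rewrite geom4 ck /m; lia.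
have mod5 s : prime s -> s %| m ->
    [/\ (s \in map fst l) && (s != c.1) & s %% 5 = 1].
  move=> ps sm; have sg : s %| geom c.1 4 by rewrite Em dvdn_mull.
  have s5 : s != 5.
    by apply: contraTneq sm => ->; rewrite /m dvdn_addl ?dvdn_mulr.
  have [/eqP|s1] := prime_dvd_geom c0 p5 ps sg; first by rewrite (negPf s5).
  have := dvd_geom_mem_other cl ps (dvdn_trans sg gd).
  rewrite (negPf s5) /= => /orP [/eqP s3|-> //].
  by move: s1; rewrite s3.
have m1 : 1 < m.
  have : 0 < k * (2 + k * (10 + k * (25 + k * 25))) by rewrite muln_gt0; lia.
  by rewrite /m; lia.
have [/andP [qX qp] q5] := mod5 _ (pdiv_prime m1) (pdiv_dvd m).
exists c.1, (pdiv m), m; split; split=> //; rewrite ?map_f ?pdiv_dvd ?(ltnW m1) //.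
by move=> s ps /(mod5 s ps) [].
Qed.

(** For [a >= 2] a factor 3 survives on the right after cancelling. The prime 5 cannot divide [m],
    being 2 modulo 3. *)
Lemma ex_mod3 : 1 < a -> exists t q m, [/\ t \in map fst l, q \in map fst l, q != t,
    t %% 3 = 1 & q %% 3 = 1] /\ [/\ geom t 2 = 3 * m, 1 < m &
    forall s, prime s -> s %| m ->
      [&& s \in map fst l, s != t & s %% 3 == 1]].
Proof.
move=> a1; have p3 : prime 3 by [].
have : 3 %| geom 3 a * \prod_(c <- l) geom c.1 c.2.
  rewrite -(@dvdn_pmul2l 3) // E dvdn_mull // dvdn_mulr //.
  by rewrite -(subnK a1) expnD dvdn_mull.
rewrite Euclid_dvdM // => /orP [|/(Euclid_dvd_prods p3) [c cl]].
  by rewrite (negPf (dvdn_self_geom _ _)).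
have [pc c5 ec] := hl cl; have c0 : 0 < c.1 by lia.
case/(dvd3_geom c0 ec) => c1 c2.
have gd : geom c.1 2 %| geom c.1 c.2 by apply: (@dvdn_geom_geom _ 3) => //; lia.
have [k ck] : exists k, c.1 = 3 * k + 1 by exists (c.1 %/ 3); lia.
set m := 1 + 3 * (k * (1 + k)).
have Em : geom c.1 2 = 3 * m by rewrite geom2 ck /m; lia.
have mod3 s : prime s -> s %| m -> [&& s \in map fst l, s != c.1 & s %% 3 == 1].
  move=> ps sm; have sg : s %| geom c.1 2 by rewrite Em dvdn_mull.
  have s3 : s != 3.
    by apply: contraTneq sm => ->; rewrite /m dvdn_addl ?dvdn_mulr.
  have [/eqP|s1] := prime_dvd_geom c0 p3 ps sg; first by rewrite (negPf s3).
  have := dvd_geom_mem_other cl ps (dvdn_trans sg gd).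
  rewrite (negPf s3) /= s1 andbT => /orP [/eqP s5|] //.
  by move: s1; rewrite s5.
have m1 : 1 < m.
  have : 0 < k * (1 + k) by rewrite muln_gt0; lia.
  by rewrite /m; lia.
have /and3P [qX qp /eqP q3] := mod3 _ (pdiv_prime m1) (pdiv_dvd m).
by exists c.1, (pdiv m), m; split; split=> //; rewrite map_f.
Qed.

End FiveThirds.

(** * Abundancy inequalities *)

(** The ratios [S / N] have product [C / D], so bounds [B / A] on each multiply. Exchanging the
    roles of [S] and [N] turns upper bounds into lower ones. *)
Lemma weighted_le C D A1 A2 A3 A4 B1 B2 B3 B4 S1 S2 S3 S4 N1 N2 N3 N4 :
  D * (S1 * (S2 * (S3 * S4))) = C * (N1 * (N2 * (N3 * N4))) ->
  0 < N1 * (N2 * (N3 * N4)) ->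
  A1 * S1 <= B1 * N1 -> A2 * S2 <= B2 * N2 -> A3 * S3 <= B3 * N3 ->
  A4 * S4 <= B4 * N4 ->
  C * (A1 * (A2 * (A3 * A4))) <= D * (B1 * (B2 * (B3 * B4))).
Proof.
move=> E N0 H1 H2 H3 H4; rewrite -(leq_pmul2r N0).
have := leq_mul (leqnn D) (leq_mul H1 (leq_mul H2 (leq_mul H3 H4))).
have -> : C * (A1 * (A2 * (A3 * A4))) * (N1 * (N2 * (N3 * N4)))
        = (A1 * (A2 * (A3 * A4))) * (D * (S1 * (S2 * (S3 * S4)))) by rewrite E; lia.
by move: E => _; congr (_ <= _); lia.
Qed.

(* The closed products that occur below are too large for unary computation. *)
Lemma leq_mul4_Z C D A1 A2 A3 A4 B1 B2 B3 B4 :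
  C * (A1 * (A2 * (A3 * A4))) <= D * (B1 * (B2 * (B3 * B4))) ->
  (Z.of_nat C * (Z.of_nat A1 * (Z.of_nat A2 * (Z.of_nat A3 * Z.of_nat A4))) <=
   Z.of_nat D * (Z.of_nat B1 * (Z.of_nat B2 * (Z.of_nat B3 * Z.of_nat B4))))%Z.
Proof. by move/leP => H; rewrite -!Nat2Z.inj_mul; apply/inj_le. Qed.

(** * The equation 3 sigma(n) = 5 n with the other primes at least 11 *)

Section ThreePrimes.

Variables (x y z a e f g : nat).
Hypotheses (px : prime x) (py : prime y) (pz : prime z).
Hypotheses (x11 : 11 <= x) (xy : x < y) (yz : y < z).
Hypotheses (a0 : 0 < a) (e0 : 0 < e) (f0 : 0 < f) (g0 : 0 < g).
Hypotheses (ea : ~~ odd a) (ee : ~~ odd e) (ef : ~~ odd f) (eg : ~~ odd g).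
Hypothesis E : 3 * (geom 3 a * (geom x e * (geom y f * geom z g)))
             = 5 * (3 ^ a * (x ^ e * (y ^ f * z ^ g))).

Let l := [:: (x, e); (y, f); (z, g)].

Lemma triple_hyp c : c \in l -> [/\ prime c.1, 5 < c.1 & ~~ odd c.2].
Proof. by rewrite !inE => /or3P [] /eqP ->; split=> //=; lia. Qed.

Lemma triple_eq : 3 * (geom 3 a * \prod_(c <- l) geom c.1 c.2)
                = 5 * (3 ^ a * \prod_(c <- l) c.1 ^ c.2).
Proof. by rewrite !big_cons !big_nil /= !muln1. Qed.

(** The bounds for 3 and [x] are left open, so that exact ratios can be used once their exponents
    are fixed. *)
Lemma triple_ub_gen A B C D v w : A * geom 3 a <= B * 3 ^ a ->
  C * geom x e <= D * x ^ e -> v < y -> w < z ->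
  5 * (A * (C * (v * w))) <= 3 * (B * (D * (v.+1 * w.+1))).
Proof.
move=> HA HC vy wz; apply: weighted_le E _ HA HC _ _; try exact: geom_ub.
by rewrite !muln_gt0 !expn_gt0 !prime_gt0.
Qed.

Lemma triple_ub A B u v w : A * geom 3 a <= B * 3 ^ a -> u < x -> v < y -> w < z ->
  5 * (A * (u * (v * w))) <= 3 * (B * (u.+1 * (v.+1 * w.+1))).
Proof. by move=> HA ux; apply: triple_ub_gen HA (geom_ub _ ux). Qed.

Lemma triple_lb A B b c d : A * 3 ^ a <= B * geom 3 a -> b <= e -> c <= f -> d <= g ->
  3 * (A * (geom x b * (geom y c * geom z d))) <= 5 * (B * (x ^ b * (y ^ c * z ^ d))).
Proof.
have flip p i j : i <= j -> geom p i * p ^ j <= p ^ i * geom p j.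
  by rewrite (mulnC (p ^ i)); apply: geom_lb.
move=> HA be cf dg; apply: weighted_le (esym E) _ HA _ _ _; try exact: flip.
by rewrite !muln_gt0 !geom_gt0.
Qed.

Lemma triple_mod5 : exists p q m, [/\ p \in [:: x; y; z], q \in [:: x; y; z], q != p,
    p %% 5 = 1 & q %% 5 = 1] /\ [/\ geom p 4 = 5 * m, 0 < m, q %| m &
    forall s, prime s -> s %| m -> (s \in [:: x; y; z]) && (s != p)].
Proof. exact: ex_mod5 ea triple_hyp triple_eq. Qed.

Lemma triple_mod3 : exists t q m, [/\ t \in [:: x; y; z], q \in [:: x; y; z], q != t,
    t %% 3 = 1 & q %% 3 = 1] /\ [/\ geom t 2 = 3 * m, 1 < m &
    forall s, prime s -> s %| m ->
      [&& s \in [:: x; y; z], s != t & s %% 3 == 1]].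
Proof.
have a1 : 1 < a by case: (a) a0 ea => [|[]].
exact: ex_mod3 triple_hyp triple_eq a1.
Qed.

Lemma mod5_23 : x %% 5 != 1 ->
  [/\ y %% 5 = 1, z %% 5 = 1 & (y %| geom z 4) || (z %| geom y 4)].
Proof.
move=> /eqP x5; have [p [q [m [[pX qX qp p5 q5] [Em _ qm _]]]]] := triple_mod5.
have : q %| geom p 4 by rewrite Em dvdn_mull.
move: pX qX qp p5 q5; rewrite !inE => /or3P [] /eqP -> /or3P [] /eqP -> //;
  rewrite ?eqxx // => _ ? ? d; split=> //; by rewrite d ?orbT.
Qed.

Lemma mod3_23 : x %% 3 != 1 -> y %% 3 = 1 /\ z %% 3 = 1.
Proof.
move=> /eqP x3; have [p [q [m [[pX qX qp p3 q3] _]]]] := triple_mod3.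
by move: pX qX qp p3 q3; rewrite !inE => /or3P [] /eqP -> /or3P [] /eqP -> //;
  rewrite ?eqxx.
Qed.

Lemma three_ub : 2 * geom 3 a <= 3 * 3 ^ a.
Proof. exact: geom_ub. Qed.

Lemma x_cases : [|| x == 11, x == 13, x == 17, x == 19 | x == 23].
Proof.
have x28 : x <= 28.
  rewrite leqNgt; apply/negP => xl.
  (* The bound is 3/2 * 29/28 * 30/29 * 31/30 = 93/56, below 5/3. *)
  by have := @triple_ub _ _ 28 29 30 three_ub; lia.
have : x \in [seq p <- iota 11 18 | prime p] by rewrite mem_filter px mem_iota; lia.
by rewrite (_ : [seq p <- _ | _] = [:: 11; 13; 17; 19; 23]) // !inE.
Qed.

Lemma two_or_four : a = 2 \/ 4 <= a.
Proof. by case: a a0 ea => [|[|[|[|]]]] //; [left|right]. Qed.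

Lemma three_lb b : b <= a -> geom 3 b * 3 ^ a <= 3 ^ b * geom 3 a.
Proof. by move=> ba; rewrite (mulnC (3 ^ b)); apply: geom_lb. Qed.

Lemma neq_of_prime p c : prime p -> ~~ prime c -> p <> c.
Proof. by move=> pp cc pc; rewrite -pc pp in cc. Qed.

Lemma mod10_23 : x %% 5 != 1 -> [/\ 31 <= y, 41 <= z, y %% 10 = 1 & z %% 10 = 1].
Proof.
case/mod5_23 => y5 z5 _.
have [? ?] : odd y /\ odd z.
  by split; [case: (even_prime py)|case: (even_prime pz)] => //; lia.
have := neq_of_prime py (isT : ~~ prime 21).
by split; lia.
Qed.

(** Since [geom 3 2] is 13, the prime 13 would occur. The abundancy is then too large if [x = 11]
    and too small if [x = 13]. *)
Lemma a_neq2 : a <> 2.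
Proof.
move=> a2.
have : 13 \in [:: x; y; z].
  apply: (dvd_geom3_mem triple_hyp triple_eq) => //.
  by rewrite a2 geom2.
have ub := @triple_ub 9 13; have lb := @triple_lb 13 9 2 2 0.
rewrite a2 geom2 in ub, lb.
rewrite !inE => h13.
have [x1|x1] := eqVneq x 11.
  have y13 : y = 13 by have := neq_of_prime py (isT : ~~ prime 12); lia.
  have := lb (leqnn _); rewrite x1 y13 !geom2 geom0 expn0; lia.
have [|y31 z41 _ _] := mod10_23; first by have := x_cases; lia.
have := ub 12 30 40; have := x_cases; lia.
Qed.

Lemma a_ge4 : 4 <= a.
Proof. by have := a_neq2; have := two_or_four; lia. Qed.

(** Otherwise [y] and [z] are 1 modulo 10, and the upper bound leaves few pairs. Each falls to a
    sharper abundancy bound, to the condition modulo 3, or to [div]. *)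
Lemma x_eq11 : x = 11.
Proof.
apply/eqP/negPn/negP => x1.
have x5 : x %% 5 != 1 by have := x_cases; lia.
have [y31 z41 y10 z10] := mod10_23 x5.
have [_ _ div] := mod5_23 x5.
have ub := triple_ub three_ub.
have lb := triple_lb (three_lb a_ge4).
have ny := neq_of_prime py; have nz := neq_of_prime pz.
have ny51 := ny 51 isT; have nz51 := nz 51 isT.
have := x_cases; rewrite (negPf x1) /= => /or4P [] /eqP x13.
- have y80 : y <= 80 by have := ub 12 80 81; lia.
  have : [|| y == 31, y == 41, y == 61 | y == 71] by lia.
  case/or4P => /eqP yE; rewrite x13 yE in ub lb div.
  + have := lb 2 2 0; rewrite !geom2 !geomS !geom0; lia.
  + have z16 : z <= 1600 by have := ub 12 40 1600; lia.
    have [t [q [m [[tX _ _ t3 _] [Em m1 sm]]]]] := triple_mod3.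
    move: tX; rewrite !inE => /or3P [] /eqP tE.
    (* [geom 13 2 = 183 = 3 * 61]. *)
    * have m61 : m = 61 by move: Em; rewrite tE x13 geom2; lia.
      have := sm 61 isT; rewrite m61 dvdnn !inE => /(_ isT) /andP [zE _].
      have {}zE : z = 61 by lia.
      by move: div; rewrite zE /dvdn !geomS_mod !geom0; vm_compute.
    * by lia.
    (* 41 is 2 modulo 3, so [z ^ 2 + z + 1 = 3 * 13 ^ j]. Size gives [j < 6] and reduction modulo 5
       gives [j = 4]; but [3 * 13 ^ 4 = 85683] lies strictly between the values of the left side at
       292 and 293. *)
    * have [j mj] : exists j, m = 13 ^ j.
        apply: prime_power_of_primes => [|s ps smm]; first lia.
        have /and3P [] := sm s ps smm; rewrite !inE x13 yE tE.
        by case/or3P => /eqP -> //; rewrite eqxx.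
      have m5 : geom z 2 = 3 %[mod 5] by rewrite -geom_modl (_ : z %% 5 = 1) ?geom1 //; lia.
      rewrite tE in Em; rewrite Em mj in m5; rewrite geom2 in Em.
      have j6 : j < 6.
        rewrite ltnNge; apply/negP => j6.
        have : 13 ^ (3 + 3) <= m by rewrite mj leq_exp2l.
        have : z * (1 + z) <= 13 ^ 3 * 13 ^ 3.
          by apply: leq_mul; rewrite (_ : 13 ^ 3 = 2197) //; lia.
        rewrite expnD; lia.
      have {}m5 : 3 * 3 ^ j = 3 %[mod 5].
        have e13 : 13 ^ j = 3 ^ j %[mod 5] by rewrite -(modnXm j 5 13).
        by rewrite -modnMmr -e13 modnMmr.
      have j4 : j = 4.
        by move: j6 mj m5 {Em sm}; case: j => [|[|[|[|[|[|j]]]]]] // _ mj _; lia.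
      rewrite mj j4 !expnS expn0 in Em.
      have [z292|z293] := leqP z 292.
        have : z * (1 + z) <= 292 * (1 + 292) by apply: leq_mul; lia.
        lia.
      have : 293 * (1 + 293) <= z * (1 + z) by apply: leq_mul; lia.
      lia.
  + have z120 : z <= 120 by have := ub 12 60 120; lia.
    have := nz 81 isT; have := nz 91 isT; have := nz 111 isT => ? ? ?.
    have : (z == 71) || (z == 101) by lia.
    by case/orP => /eqP zE; move: div; rewrite zE /dvdn !geomS_mod !geom0; vm_compute.
  + by have := nz 81 isT; have := ub 12 70 90; lia.
- have [|y3 z3] := mod3_23; first by rewrite x13.
  have y31' : y = 31 by have := ub 16 60 90; lia.
  have z61 : z = 61 by have := nz 91 isT; have := ub 16 30 90; lia.
  by move: div; rewrite y31' z61 /dvdn !geomS_mod !geom0; vm_compute.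
- have y31' : y = 31 by have := ub 18 40 50; lia.
  have z41' : z = 41 by have := ub 18 30 60; lia.
  by move: div; rewrite y31' z41' /dvdn !geomS_mod !geom0; vm_compute.
- have [|y3 z3] := mod3_23; first by rewrite x13.
  by have := ub 22 30 60; lia.
Qed.

(** * The case [x = 11] *)

Lemma yz_mod3 : y %% 3 = 1 /\ z %% 3 = 1.
Proof. by apply: mod3_23; rewrite x_eq11. Qed.

Lemma yz_mod6 : y %% 6 = 1 /\ z %% 6 = 1.
Proof.
have [y3 z3] := yz_mod3; have [? ?] : odd y /\ odd z.
  by split; [case: (even_prime py)|case: (even_prime pz)] => //; lia.
by split; lia.
Qed.

Lemma eleven_mod5 : y %% 5 = 1 \/ z %% 5 = 1 /\ 11 %| geom z 4.
Proof.
have [y3 z3] := yz_mod3.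
have [p [q [m [[pX qX qp p5 q5] [Em m0 qm sm]]]]] := triple_mod5.
have qg : q %| geom p 4 by rewrite Em dvdn_mull.
move: pX; rewrite !inE => /or3P [] /eqP pE.
- (* [geom 11 4 / 5] is 2 modulo 3, so it has a prime factor that is not 1 modulo 3. *)
  have m3 : m %% 3 = 1.
    apply: modn1_of_primes => // s ps sm'.
    have := sm s ps sm'; rewrite !inE pE => /andP [/or3P [] /eqP -> //].
    by rewrite eqxx.
  have : geom p 4 %% 3 = 1 by rewrite pE x_eq11 -geom_modl geom4.
  by rewrite Em -modnMmr m3.
- by left; rewrite -pE.
- rewrite pE in p5 qg qp; move: qX qg; rewrite !inE => /or3P [] /eqP qE.
  + by rewrite qE x_eq11 => ?; right.
  + by left; rewrite -qE.
  + by rewrite qE eqxx in qp.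
Qed.

(** As 11 is 2 modulo 3, the cofactor given by [triple_mod3] has only one possible prime factor. *)
Lemma eleven_mod3 : exists2 j, 0 < j &
  geom y 2 = 3 * z ^ j \/ geom z 2 = 3 * y ^ j.
Proof.
have [t [q [m [[tX _ _ t3 _] [Em m1 sm]]]]] := triple_mod3.
have aux r : (forall s, prime s -> s %| m -> s = r) -> exists2 j, 0 < j & m = r ^ j.
  case/(prime_power_of_primes (ltnW m1)) => j mj; exists j => //.
  by case: j mj m1 => // ->.
have x3 : x %% 3 == 1 = false by rewrite x_eq11.
move: tX; rewrite !inE => /or3P [] /eqP tE.
- by move: x3; rewrite -tE t3.
- case: (aux z) => [s ps smm|j j0 mj].
    have /and3P [] := sm s ps smm; rewrite !inE tE.
    by case/or3P => /eqP -> //; rewrite ?x3 ?eqxx.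
  by exists j => //; left; rewrite -tE Em mj.
- case: (aux y) => [s ps smm|j j0 mj].
    have /and3P [] := sm s ps smm; rewrite !inE tE.
    by case/or3P => /eqP -> //; rewrite ?x3 ?eqxx.
  by exists j => //; right; rewrite -tE Em mj.
Qed.

Lemma e_ge2 : 2 <= e. Proof. by case: e e0 ee => [|[]]. Qed.

Lemma f_ge2 : 2 <= f. Proof. by case: f f0 ef => [|[]]. Qed.

Lemma g_ge2 : 2 <= g. Proof. by case: g g0 eg => [|[]]. Qed.

(** Exponents at least 4, 2, 2 on 3, 11, [y] give abundancy at least [133/81 * (1 + 1/y + 1/y^2)],
    which exceeds 5/3 for [y <= 67]. *)
Lemma y_ge73 : 73 <= y.
Proof.
have [y6 _] := yz_mod6.
have := triple_lb (three_lb a_ge4) e_ge2 f_ge2 (leq0n g).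
rewrite x_eq11 !geom2 !geomS !geom0 !expnS !expn0 !muln1.
have [y67|] := leqP y 67; last by have := neq_of_prime py (isT : ~~ prime 69); lia.
nia.
Qed.

(** Clearing denominators in 3/2 * 11/10 * [y/(y-1) * z/(z-1)] >= 5/3 gives
    [y z + 100 <= 100 y + 100 z]. If [y <= 100], truncation makes the left side 0. *)
Lemma yz_ub : (y - 100) * (z - 100) <= 99 * 100.
Proof.
have [y100|/ltnW y100] := leqP y 100; first by rewrite (eqP (_ : y - 100 == 0)).
have [[u yu] [v zv]] : (exists u, y = u + 100) /\ exists v, z = v + 100.
  by split; [exists (y - 100)|exists (z - 100)]; lia.
have ux : 10 < x by rewrite x_eq11.
have uy : u + 99 < y by lia.
have vz : v + 99 < z by lia.
have := triple_ub three_ub ux uy vz.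
rewrite yu zv !addnK; lia.
Qed.

(* For [y] = 73, 79 or 97, once the small exponents are fixed, the abundancy without
   the factor of [z] stays away from 5/3, which bounds [z]. *)
Lemma z_le8000 : y < 103 -> z <= 80 * 100.
Proof.
move=> y103; rewrite leqNgt; apply/negP => z8.
have y73 := y_ge73; have [y6 _] := yz_mod6.
have ub3 A B C D v (HA : A * geom 3 a <= B * 3 ^ a) (HC : C * geom x e <= D * x ^ e)
  (vy : v < y) := leq_mul4_Z (triple_ub_gen HA HC vy z8).
have lb3 b c (ba : b <= a) (ce : c <= e) :=
  leq_mul4_Z (triple_lb (three_lb ba) ce f_ge2 (leq0n g)).
have ex3 : 3 ^ a * geom 3 a <= geom 3 a * 3 ^ a by rewrite mulnC.
have exx : x ^ e * geom x e <= geom x e * x ^ e by rewrite mulnC.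
have ubx : 10 * geom x e <= 11 * x ^ e by apply: geom_ub; rewrite x_eq11.
have [a4|a6] := leqP a 5.
  have aE : a = 4 by have := a_ge4; lia.
  have := ub3 _ _ _ _ 72 ex3 ubx y73.
  rewrite aE !geomS !geom0 !expnS expn0; lia.
have yE : [|| y == 73, y == 79 | y == 97].
  by have := neq_of_prime py (isT : ~~ prime 85); have := neq_of_prime py (isT : ~~ prime 91); lia.
(* This lower bound already passes 5/3 for 73 and 79. For 97 that takes [a >= 8] and [e >= 4]; with
   [a = 6] or [e = 2] the upper bound stays below 5/3. *)
have lb2 := lb3 6 2 a6 e_ge2.
case/or3P: yE => /eqP yE; rewrite yE in ub3 lb3 lb2.
- by move: lb2; rewrite x_eq11 !geomS !geom0 !expnS !expn0; lia.
- by move: lb2; rewrite x_eq11 !geomS !geom0 !expnS !expn0; lia.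
have [a7|a8] := leqP a 7.
  have aE : a = 6 by case: (a) a6 a7 ea => [|[|[|[|[|[|[|[|]]]]]]]].
  have := ub3 _ _ _ _ 96 ex3 ubx isT.
  rewrite aE !geomS !geom0 !expnS expn0; lia.
have [e3|e4] := leqP e 3.
  have eE : e = 2 by case: (e) e0 e3 ee => [|[|[|[|]]]].
  have := ub3 _ _ _ _ 96 three_ub exx isT.
  rewrite eE x_eq11 !geomS !geom0 !expnS expn0; lia.
have := lb3 8 4 a8 e4; rewrite x_eq11 !geomS !geom0 !expnS !expn0; lia.
Qed.

Lemma no_five_thirds : False.
Proof.
have y73 := y_ge73; have [y6 z6] := yz_mod6; have ub := yz_ub.
have m5 r : r %% 5 = 1 -> geom r 2 = 3 %[mod 5].
  by move=> r5; rewrite -geom_modl r5 geom1.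
have yS : y < 103 -> [|| y == 73, y == 79 | y == 97].
  have := neq_of_prime py (isT : ~~ prime 85).
  by have := neq_of_prime py (isT : ~~ prime 91); lia.
have z5 : y %% 5 != 1 -> z %% 5 = 1 /\ 11 %| geom z 4.
  by case: eleven_mod5 => [->|].
have [j j0 [yE|zE]] := eleven_mod3.
  (* [z > y] forces [y ^ 2 + y + 1 = 3 * z]. Then [yz_ub] excludes [y >= 103], and among 73, 79, 97
     only 73 makes [z] 1 modulo 5. *)
  have j1 : j = 1.
    case: j j0 yE => [|[|j]] // _; rewrite geom2 => yE.
    have : z * z <= z ^ j.+2 by rewrite mulnn (leq_exp2l _ _ (prime_gt1 pz)).
    have : y * (1 + y) <= z * z by apply: leq_mul; lia.
    have : 1 * 1 <= y * (1 + y) by apply: leq_mul; lia.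
    lia.
  rewrite j1 expn1 geom2 in yE.
  have [y103|/yS] := leqP 103 y.
    have z3571 : 3571 <= z.
      have : 103 * (1 + 103) <= y * (1 + y) by apply: leq_mul; lia.
      lia.
    have : 3 * 3471 <= (y - 100) * (z - 100) by apply: leq_mul; lia.
    lia.
  case/or3P => /eqP yv; rewrite yv in yE z5; have [z51 d11] := z5 isT; try lia.
  have zv : z = 1801 by lia.
  by move: d11; rewrite dvdn_geom zv geom4; vm_compute.
(* The remaining equation is [z ^ 2 + z + 1 = 3 * y ^ j]; size and residues modulo 5 will reduce it
   to [j = 2]. *)
have j2 : 2 <= j.
  case: j j0 zE => [|[|j]] // _; rewrite geom2 expn1 => zE.
  have : z * 3 <= z * (1 + z) by apply: leq_mul; lia.
  lia.
have zz := zE; rewrite geom2 in zz.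
have mj : z %% 5 = 1 -> 3 * (y %% 5) ^ j = 3 %[mod 5].
  by move=> /m5 <-; rewrite zE -modnMmr modnXm modnMmr.
have [y103|y103] := leqP 103 y; last first.
  have [z51 _] : z %% 5 = 1 /\ 11 %| geom z 4.
    by apply: z5; have := yS y103; lia.
  have z8 := z_le8000 y103.
  have j4 : j < 4.
    rewrite ltnNge; apply/negP => j4.
    have w2 : y ^ 2 * y ^ 2 <= y ^ j by rewrite -expnD leq_pexp2l //; lia.
    have w1 : 73 * 73 <= y ^ 2 by rewrite -mulnn leq_mul.
    have : (3 * z) * (3 * (1 + z)) <= (5 * y ^ 2) * (5 * y ^ 2) by apply: leq_mul; lia.
    have : 3 * 3 <= y ^ 2 * y ^ 2 by apply: leq_mul; lia.
    lia.
  (* 73, 79, 97 are 3, 4, 2 modulo 5; among their squares and cubes only [4 ^ 2] is 1. *)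
  have {}j2 : j = 2.
    have := mj z51; case: (j) j2 j4 => [|[|[|[|]]]] // _ _.
    by case/or3P: (yS y103) => /eqP ->.
  rewrite j2 -mulnn in zz.
  have z2y : z < 2 * y.
    rewrite ltnNge; apply/negP => y2z.
    have : (2 * y) * (2 * y) <= z * (1 + z) by apply: leq_mul; lia.
    have : 1 * 1 <= y * y by apply: leq_mul; lia.
    lia.
  have := triple_lb (three_lb a_ge4) e_ge2 f_ge2 g_ge2.
  rewrite x_eq11 !geom2 !geomS !geom0 !expnS !expn0 !muln1.
  have zz2 : z * z <= z * (2 * y) by apply: leq_mul; lia.
  by case/or3P: (yS y103) => /eqP yv; rewrite yv in zz2 *; lia.
have z3400 : z <= 3400.
  have : 3 * (z - 100) <= (y - 100) * (z - 100) by apply: leq_mul; lia.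
  lia.
have j4 : j < 4.
  rewrite ltnNge; apply/negP => j4.
  have : y ^ 4 <= y ^ j by rewrite leq_pexp2l //; lia.
  rewrite !expnS expn0.
  have : (103 * 103) * (y * y) <= (y * y) * (y * y) by do 2 apply: leq_mul => //.
  have : z * (1 + z) <= (34 * y) * (34 * y) by apply: leq_mul; lia.
  have : 1 * 1 <= y * y by apply: leq_mul; lia.
  lia.
have y109 : 109 <= y.
  have [//|y109] := leqP 109 y.
  have yv : y = 103 by lia.
  have [z51 _] : z %% 5 = 1 /\ 11 %| geom z 4 by apply: z5; rewrite yv.
  by have := mj z51; rewrite yv; case: (j) j2 j4 => [|[|[|[|]]]].
have y2 : 109 * y <= y * y by rewrite leq_mul2r y109 orbT.
have {j2 j4}j2 : j = 2.
  suff : j <> 3 by lia.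
  move=> j3; rewrite j3 !expnS expn0 in zz.
  have z12 : z < 12 * y.
    have : 9 * (z - 100) <= (y - 100) * (z - 100) by apply: leq_mul; lia.
    lia.
  have : z * (1 + z) <= (12 * y) * (12 * y) by apply: leq_mul; lia.
  have : 109 * (y * y) <= y * (y * y) by rewrite leq_mul2r y109 orbT.
  lia.
rewrite j2 -mulnn in zz.
(* 17/10 approximates the square root of 3 from below. *)
have z17 : 17 * y <= 10 * z.
  rewrite leqNgt; apply/negP => z17.
  have : (10 * z) * (10 * (1 + z)) <= (17 * y) * (17 * y + 9) by apply: leq_mul; lia.
  lia.
have y163 : y < 163.
  rewrite ltnNge; apply/negP => y163.
  have : 63 * 178 <= (y - 100) * (z - 100) by apply: leq_mul; lia.
  lia.
(* [r * (1 + r)] increases, so [3 * y ^ 2 - 1] strictly between consecutive values is impossible.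
   This settles 109, 139 and 151; 127 and 157 are 2 modulo 5, where [mj2] fails. *)
have between r : r * (1 + r) < z * (1 + z) < r.+1 * (1 + r.+1) -> False.
  case/andP => r1 r2; have [zr|rz] := leqP z r.
    have : z * (1 + z) <= r * (1 + r) by apply: leq_mul; lia.
    lia.
  have : r.+1 * (1 + r.+1) <= z * (1 + z) by apply: leq_mul; lia.
  lia.
have y_cases : [|| y == 109, y == 127, y == 139, y == 151 | y == 157].
  have : y \in [seq p <- iota 109 54 | prime p && (p %% 6 == 1)].
    by rewrite mem_filter mem_iota py y6; lia.
  by rewrite (_ : [seq p <- _ | _] = [:: 109; 127; 139; 151; 157]) // !inE.
have mj2 : y %% 5 != 1 -> 3 * (y %% 5) ^ 2 = 3 %[mod 5].
  by move=> y5; have [z51 _] := z5 y5; have := mj z51; rewrite j2.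
case/or4P: y_cases => [||| /orP []] /eqP yv; rewrite yv in zz mj2.
- by apply: (between 188); lia.
- by have := mj2 isT.
- by apply: (between 240); lia.
- by apply: (between 261); lia.
- by have := mj2 isT.
Qed.

End ThreePrimes.

(** * The equation 9 sigma(n) = 17 n *)

(** The upper bound leaves only 11, 13, 17. A prime factor of [geom 11 e] would be 3, 11, 13 or 17,
    but -1 is a power of 11 modulo 3, 13 and 17. *)
Lemma no_seventeen_ninths x y z a e f g :
  prime x -> prime y -> prime z -> 11 <= x -> x < y -> y < z ->
  0 < e -> ~~ odd e ->
  9 * (geom 3 a * (geom x e * (geom y f * geom z g)))
    <> 17 * (3 ^ a * (x ^ e * (y ^ f * z ^ g))).
Proof.
move=> px py pz x11 xy yz e0 ee E.
have ub u v w (ux : u < x) (vy : v < y) (wz : w < z) :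
    17 * (2 * (u * (v * w))) <= 9 * (3 * (u.+1 * (v.+1 * w.+1))).
  apply: weighted_le E _ (geom_ub a (isT : 2 < 3)) _ _ _; try exact: geom_ub.
  by rewrite !muln_gt0 !expn_gt0 !prime_gt0.
have nx := neq_of_prime px; have ny := neq_of_prime py; have nz := neq_of_prime pz.
have xE : x = 11 by have := nx 12 isT; have := ub 12 13 14; lia.
have yE : y = 13.
  have := ny 12 isT; have := ny 14 isT; have := ny 15 isT; have := ny 16 isT.
  by have := ub 10 16 17; lia.
have zE : z = 17.
  have := nz 14 isT; have := nz 15 isT; have := nz 16 isT; have := nz 18 isT.
  by have := ub 10 12 18; lia.
have g1 : 1 < geom x e.
  by case: (e) e0 => // b _; rewrite geomS; have := geom_gt0 x b; nia.
have pq := pdiv_prime g1; have := pdiv_dvd (geom x e).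
move: (pdiv _) pq => q pq qd.
have : q %| 17 * (3 ^ a * (x ^ e * (y ^ f * z ^ g))).
  by rewrite -E dvdn_mull // dvdn_mull // dvdn_mulr.
rewrite !Euclid_dvdM // !Euclid_dvdX // xE yE zE.
rewrite (dvdn_prime2 pq (isT : prime 17)) (dvdn_prime2 pq (isT : prime 3)).
rewrite (dvdn_prime2 pq (isT : prime 11)) (dvdn_prime2 pq (isT : prime 13)).
(* Splitting the exponent as [i * j] with a reduction in between keeps the computed numbers
   small. *)
have nd i j r : 2 < r -> (11 ^ i %% r) ^ j = r.-1 %[mod r] -> q != r.
  rewrite modnXm -expnM => r2 hr; apply: contraTneq qd => ->.
  by rewrite xE; apply: (@geom_ndvd _ (i * j)).
have n11 : q != 11.
  by apply: contraTneq qd => ->; rewrite xE; apply: dvdn_self_geom.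
have n3 : q != 3 by apply: (nd 1 1).
have n13 : q != 13 by apply: (nd 2 3).
have n17 : q != 17 by apply: (nd 2 4).
by rewrite (negPf n3) (negPf n11) (negPf n13) (negPf n17).
Qed.

(** * Four prime factors: reduction to the two equations *)

Lemma sigma_four p1 p2 p3 p4 a1 a2 a3 a4 :
  prime p1 -> prime p2 -> prime p3 -> prime p4 -> p1 < p2 -> p2 < p3 -> p3 < p4 ->
  sigma (p1 ^ a1 * p2 ^ a2 * p3 ^ a3 * p4 ^ a4)
    = geom p1 a1 * (geom p2 a2 * (geom p3 a3 * geom p4 a4)).
Proof.
move=> hp1 hp2 hp3 hp4 h12 h23 h34.
have cop p q i j : prime p -> prime q -> p < q -> coprime (p ^ i) (q ^ j).
  move=> pp pq pltq; apply/coprimeXl/coprimeXr.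
  by rewrite prime_coprime // dvdn_prime2 // neq_ltn pltq.
have h13 := ltn_trans h12 h23; have h24 := ltn_trans h23 h34.
have h14 := ltn_trans h12 h24.
rewrite !sigma_coprime ?sigma_pfactor ?muln_gt0 ?expn_gt0 ?prime_gt0 //;
  rewrite ?coprimeMl ?cop //.
by rewrite !mulnA.
Qed.

Theorem theorem1p1 (n p1 p2 p3 p4 a1 a2 a3 a4 : nat)
    (hodd : odd n) (hdp : deficient_perfect n)
    (hp1 : prime p1) (hp2 : prime p2) (hp3 : prime p3) (hp4 : prime p4)
    (h12 : p1 < p2) (h23 : p2 < p3) (h34 : p3 < p4)
    (ha1 : 1 <= a1) (ha2 : 1 <= a2) (ha3 : 1 <= a3) (ha4 : 1 <= a4)
    (hn : n = p1 ^ a1 * p2 ^ a2 * p3 ^ a3 * p4 ^ a4) :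
  p1 = 3 /\ 5 <= p2 <= 7.
Proof.
case: hdp => n0 [d [d0 dn ltdn sn]].
have sE := sigma_four a1 a2 a3 a4 hp1 hp2 hp3 hp4 h12 h23 h34.
rewrite -hn in sE.
have [o1 o2 o3 o4] : [/\ odd p1, odd p2, odd p3 & odd p4].
  move: hodd; rewrite hn !oddM !oddX !eqn0Ngt ha1 ha2 ha3 ha4 /=.
  by case/andP => /andP [] /andP [].
have [e1 e2 e3 e4] : [/\ ~~ odd a1, ~~ odd a2, ~~ odd a3 & ~~ odd a4].
  have : odd (sigma n).
    rewrite sn oddB; last by lia.
    by rewrite mul2n odd_double (dvdn_odd dn hodd).
  rewrite sE !oddM !odd_geom //.
  by case/andP => -> /andP [-> /andP [-> ->]].
have [k nk] := dvdnP dn.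
have k1 : 1 < k.
  case: (k) nk => [|[|//]] nk; first by rewrite nk in n0.
  by rewrite nk mul1n ltnn in ltdn.
have ok : odd k by move: hodd; rewrite nk oddM => /andP [].
have E : k * (geom p1 a1 * (geom p2 a2 * (geom p3 a3 * geom p4 a4)))
   = (2 * k - 1) * (p1 ^ a1 * (p2 ^ a2 * (p3 ^ a3 * p4 ^ a4))).
  have -> : p1 ^ a1 * (p2 ^ a2 * (p3 ^ a3 * p4 ^ a4)) = n by rewrite hn !mulnA.
  have sd : 2 * n - d = (2 * k - 1) * d by rewrite nk mulnBl mul1n mulnA.
  by rewrite -sE sn sd nk mulnCA.
have ub u1 u2 u3 u4 (l1 : u1 < p1) (l2 : u2 < p2) (l3 : u3 < p3) (l4 : u4 < p4) :
    (2 * k - 1) * (u1 * (u2 * (u3 * u4)))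
      <= k * (u1.+1 * (u2.+1 * (u3.+1 * u4.+1))).
  apply: weighted_le E _ _ _ _ _; try exact: geom_ub.
  by rewrite !muln_gt0 !expn_gt0 !prime_gt0.
have kp q : prime q -> q %| k -> [|| q == p1, q == p2, q == p3 | q == p4].
  move=> pq qk; have : q %| n by rewrite nk dvdn_mulr.
  rewrite hn !Euclid_dvdM // !Euclid_dvdX // !dvdn_prime2 //.
  by rewrite ha1 ha2 ha3 ha4 !andbT !orbA.
have k39 : p1 = 3 -> 11 <= p2 -> k <> 3 /\ k <> 9.
  move=> p13 p211; rewrite p13 in E; split=> kE; rewrite kE in E.
    exact: no_five_thirds hp2 hp3 hp4 p211 h23 h34 ha1 ha2 ha3 ha4 e1 e2 e3 e4 E.
  exact: no_seventeen_ninths hp2 hp3 hp4 p211 h23 h34 ha2 e2 E.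
have n2 := neq_of_prime hp2; have n3 := neq_of_prime hp3; have n4 := neq_of_prime hp4.
have p1g := prime_gt1 hp1.
move: ub kp {hodd hn n0 dn ltdn sn d0 nk sE E} => ub kp.
have nd q : prime q -> q < p1 \/ p1 < q < p2 -> ~~ (q %| k).
  by move=> pq pqp; apply/negP => /(kp q pq); lia.
have [p13|p13] := eqVneq p1 3; last first.
  have p5 : 5 <= p1 by lia.
  (* [k] is odd and prime to 3, so its ratio [(2 k - 1) / k] is at least 9/5, above 5/4 * 7/6 *
     11/10 * 13/12. *)
  have k5 : 5 <= k by have := nd 3 isT; lia.
  by have := n3 9 isT; have := ub 4 6 10 12; lia.
split=> //; have p25 : 5 <= p2 by lia.
rewrite p25 leqNgt; apply/negP => p27.
have p211 : 11 <= p2 by have := n2 9 isT; lia.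
(* Here 3/2 * 11/10 * 13/12 * 17/16 is below 21/11. Being odd and divisible by neither 5 nor 7, [k]
   is then 3 or 9. *)
have k11 : k < 11 by have := n4 15 isT; have := ub 2 10 12 16; lia.
have [k3 k9] := k39 p13 p211.
by have := nd 5 isT; have := nd 7 isT; lia.
Qed.
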